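(* Let $n\ge 2$, $p\in(0,1)$, $s\in(0,1]$ and $\beta\in[0,1)$ with $\beta n$ an integer (the parameters $p,s,\beta$ may depend on $n$), and let $G_1,G_2,\pi^*,\pi$ be generated by the correlated Erdős–Rényi model with partially-correct seeds described in the context. Suppose $$\beta\ \ge\ \max\left\{\frac{45\log n}{np(1-p)^2s^2},\ 30\sqrt{\frac{\log n}{n(1-p)^2s^2}}\right\}.$$ Then for all sufficiently large $n$, the output $\tilde\pi$ of the 1-hop algorithm (the algorithm of the context with $j=1$) satisfies $\mathbb{P}(\tilde\pi=\pi^* )\ge 1-n^{-1}$.
   Context: Model: a parent graph $G_0$ on vertex set $[n]=\{1,\dots,n\}$ is drawn from the Erdős–Rényi model $\mathcal G(n,p)$ (each pair joined independently with probability $p$). $G_1$ is obtained by keeping each edge of $G_0$ independently with probability $s$. Independently, another subgraph is obtained by keeping each edge of $G_0$ independently with probability $s$, and $G_2$ is obtained from it by relabeling vertices by an unknown permutation $\pi^*:[n]\to[n]$ (vertex $u$ becomes $\pi^*(u)$). A seed mapping $\pi:[n]\to[n]$ is drawn uniformly at random, independently of $G_0,G_1,G_2$, from all permutations $\sigma$ of $[n]$ with $\sigma(u)=\pi^*(u)$ for exactly $\beta n$ vertices $u$. For a graph $G$, $d^G(u,v)$ is the shortest-path distance. For $j\ge1$ and $u,v\in[n]$, the number of $j$-hop witnesses of $(u,v)$ is $W_j(u,v)=|\{w\in[n]: d^{G_1}(u,w)=j,\ d^{G_2}(v,\pi(w))=j\}|$ (equivalently $W_j=A_j\Pi B_j$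 where $A_j,B_j$ are the $j$-hop adjacency matrices of $G_1,G_2$ and $\Pi$ the permutation matrix of $\pi$). The $j$-hop algorithm computes $W_j$ and applies greedy maximum weight matching: repeatedly select, among pairs $(u,v)$ with $u$ not yet matched (vertex of $G_1$) and $v$ not yet matched (vertex of $G_2$), a pair with largest $W_j(u,v)$, match them, and continue until all vertices are matched; the output is $\tilde\pi(u)=v$ for matched pairs. *)

(* Defs.v *)
(* Libraries: Mathematical Components and MathComp-Analysis. *)
From HB Require Import structures.
From mathcomp Require Import all_boot all_order all_fingroup all_algebra.
From mathcomp Require Import reals exp.

Set Implicit Arguments.
Unset Strict Implicit.
Unset Printing Implicit Defensive.

Import Order.TTheory GRing.Theory Num.Theory.
Local Open Scope ring_scope.

(* The vertex set [n] is 'I_n. A graph is identified with its edge set, an edge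
   being a two-element set of vertices. The type does not enforce cardinality 2:
   the laws below charge only subsets of [vertex_pairs n], and [adj] ignores
   members of any other size. *)
Definition graph (n : nat) := {set {set 'I_n}}.

Definition vertex_pairs (n : nat) : graph n := [set e : {set 'I_n} | #|e| == 2%N].

Definition adj (n : nat) (G : graph n) : rel 'I_n :=
  fun u v => (u != v) && ([set u; v] \in G).

Definition has_walk (n : nat) (G : graph n) (u v : 'I_n) (k : nat) : bool :=
  [exists q : k.-tuple 'I_n, path (adj G) u q && (last u q == v)].

(* A shortest path has fewer than n edges, so the search over k < n is
   exhaustive; [None] stands for infinite distance. *)
Definition graph_dist (n : nat) (G : graph n) (u v : 'I_n) : option nat :=
  let k := find (has_walk G u v) (iota 0 n) in
  if (k < n)%N then Some k else None.

Definition relabel (n : nat) (f : {perm 'I_n}) (G : graph n) : graph n :=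
  [set [set f x | x in e] | e : {set 'I_n} in G].

Definition witnesses (n j : nat) (G1 G2 : graph n) (sigma : {perm 'I_n})
    (u v : 'I_n) : nat :=
  #|[set w : 'I_n | (graph_dist G1 u w == Some j) &&
                    (graph_dist G2 v (sigma w) == Some j)]|.

Definition unmatched (n : nat) (r : seq ('I_n * 'I_n)) (x : 'I_n * 'I_n) : bool :=
  (x.1 \notin unzip1 r) && (x.2 \notin unzip2 r).

(* [greedy_run W r]: [r] lists, latest first, the pairs matched so far by greedy
   maximum weight matching. Ties may be broken in any way. *)
Inductive greedy_run (n : nat) (W : 'I_n -> 'I_n -> nat) :
    seq ('I_n * 'I_n) -> Prop :=
| greedy_start : greedy_run W [::]
| greedy_select r x of
    greedy_run W r &
    unmatched r x &
    (forall y, unmatched r y -> (W y.1 y.2 <= W x.1 x.2)%N) :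
    greedy_run W (x :: r).

Definition greedy_output (n : nat) (W : 'I_n -> 'I_n -> nat)
    (tau : {perm 'I_n}) : Prop :=
  exists2 r, greedy_run W r & forall u, (u, tau u) \in r.

(* [alg] computes, from G1, G2 and the seed mapping, an output of greedy matching
   on the j-hop witness counts; different tie-breaking rules give different [alg]. *)
Definition is_hop_algorithm (n j : nat)
    (alg : graph n -> graph n -> {perm 'I_n} -> {perm 'I_n}) : Prop :=
  forall G1 G2 sigma,
    greedy_output (witnesses j G1 G2 sigma) (alg G1 G2 sigma).

(* Probability that the random subset of D keeping each element independently
   with probability q equals E. *)
Definition bernoulli_subset (R : realType) (T : finType) (D : {set T}) (q : R)
    (E : {set T}) : R :=
  if E \subset D then \prod_(e in D) (if e \in E then q else 1 - q) else 0.

Definition uniform_on (R : realType) (T : finType) (A : {set T}) (x : T) : R :=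
  if x \in A then #|A|%:R^-1 else 0.

Definition seed_mappings (R : realType) (n : nat) (beta : R)
    (pistar : {perm 'I_n}) : {set {perm 'I_n}} :=
  [set sigma : {perm 'I_n} |
    #|[set u : 'I_n | sigma u == pistar u]|%:R == beta * n%:R].

(* Probability of an event about (G1, G2, pi). G0 is the parent graph, and H is
   the second subgraph before relabelling: G1 and H are conditionally independent
   given G0, and the seed mapping sigma is independent of all graphs. *)
Definition model_prob (R : realType) (n : nat) (p s beta : R)
    (pistar : {perm 'I_n})
    (event : graph n -> graph n -> {perm 'I_n} -> bool) : R :=
  \sum_(G0 : graph n) \sum_(G1 : graph n) \sum_(H : graph n)
    \sum_(sigma : {perm 'I_n} | event G1 (relabel pistar H) sigma)
      bernoulli_subset (vertex_pairs n) p G0 *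
      bernoulli_subset G0 s G1 *
      bernoulli_subset G0 s H *
      uniform_on R (seed_mappings beta pistar) sigma.

(* Main.v *)
(* Write tau = pistar^-1 o sigma, k = beta n for its number of fixed points,
   D = k p s^2, Delta = D (1 - p) and V = n (p s)^2. The witness count of
   (u, pistar x) is the number of w with uw in G1 and x(tau w) in the unrelabelled
   second graph. For x <> u it has mean about V; for x = u it has mean about V + Delta. Greedy
   matching outputs pistar as soon as every true pair beats the other pairs in its
   row, so it suffices that counts of true pairs exceed V + Delta / 2 and those
   of wrong pairs stay below it; both follow from exponential moments at
   lam = 12 ln n / Delta. For a wrong pair all but two of the summands are
   independent. For a true pair the summands w and tau w are dependent; a proper
   3-colouring of the cycles of tau together with the convexity of exp reduces
   to one colour class at a time, at the price of tripling lam on the non-fixed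
   points. *)

Require Import Defs.
From HB Require Import structures.
From mathcomp Require Import all_boot all_order all_fingroup all_algebra.
From mathcomp Require Import reals exp.
From mathcomp Require Import sequences ring lra.

Set Implicit Arguments.
Unset Strict Implicit.
Unset Printing Implicit Defensive.

Import Order.TTheory GRing.Theory Num.Theory.
Local Open Scope ring_scope.

(** * Elementary bounds on the exponential *)

(** The bound [(1 + x / 4) ^+ 4 <= expR x] yields the coefficient 3/8 for [x ^+ 2] in a minorant of
    [expR x]; then 5/8 = 1 - 3/8 cancels the quadratic term of the product, leaving 1 plus
    nonnegative terms. *)
Lemma expRN_le_quadratic (R : realType) (x : R) :
  0 <= x -> expR (- x) <= 1 - x + 5 / 8 * x ^+ 2.
Proof.
move=> x0; rewrite -(ler_pM2l (expR_gt0 x)) expRxMexpNx_1.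
have h : (1 + x / 4) ^+ 4 <= expR x.
  have {2}-> : x = 4%:R * (x / 4) by lra.
  by rewrite expRM_natl lerXn2r ?nnegrE ?expR_ge0 ?expR_ge1Dx//; lra.
have x3 : 0 <= x ^+ 3 by rewrite exprn_ge0.
have h2 : 1 + x + 3 / 8 * x ^+ 2 <= expR x.
  apply: le_trans h; have -> : (1 + x / 4) ^+ 4 =
    1 + x + 3 / 8 * x ^+ 2 + x ^+ 3 / 16 + (x ^+ 2) ^+ 2 / 256 by field.
  have := sqr_ge0 (x ^+ 2); lra.
apply: le_trans (_ : (1 + x + 3 / 8 * x ^+ 2) * (1 - x + 5 / 8 * x ^+ 2) <= _).
  have -> : (1 + x + 3 / 8 * x ^+ 2) * (1 - x + 5 / 8 * x ^+ 2) =
    1 + x ^+ 3 / 4 + 15 / 64 * (x ^+ 2) ^+ 2 by field.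
  have := sqr_ge0 (x ^+ 2); lra.
by apply: ler_wpM2r => //; nra.
Qed.

(** Follows from [expR x * (1 - x) <= 1]; multiplying the quadratic by [1 - x] gives 1 + x^2/2 -
    3x^3/2, which is at least 1 exactly because x <= 1/3. *)
Lemma expR_le_quadratic (R : realType) (x : R) :
  0 <= x <= 1 / 3 -> expR x <= 1 + x + 3 / 2 * x ^+ 2.
Proof.
move=> /andP[x0 x1]; have h := expR_ge1Dx (- x).
have e := expRxMexpNx_1 x; have p := expR_gt0 x.
have : expR x * (1 - x) <= 1 by rewrite -[leRHS]e ler_pM2l.
have : 1 <= (1 + x + 3 / 2 * x ^+ 2) * (1 - x) by nra.
by move=> h1 h2; rewrite -(@ler_pM2r _ (1 - x)) ?(le_trans h2)//; lra.
Qed.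

(** Jensen's inequality: the tangent at the mean [m] lies below [expR], and its linear terms sum to
    zero. *)
Lemma expR_mean3 (R : realType) (f : 'I_3 -> R) :
  expR (3^-1 * \sum_c f c) <= 3^-1 * \sum_c expR (f c).
Proof.
set m := 3^-1 * _.
have tangent c : expR m * (1 + (f c - m)) <= expR (f c).
  have -> : expR (f c) = expR m * expR (f c - m) by rewrite -expRD addrC subrK.
  by rewrite ler_wpM2l ?expR_ge0// expR_ge1Dx.
rewrite mulrC ler_pdivlMr ?ltr0n//.
apply: le_trans (ler_sum _ (fun c _ => tangent c)).
rewrite -mulr_sumr big_split /= sumrB !big_const_ord !iter_addr_0.
have -> : \sum_c f c = m *+ 3 by rewrite /m -mulr_natl mulrA divff ?mul1r// pnatr_eq0.
by rewrite subrr addr0.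
Qed.

(** * Expectations over the correlated pair of graphs *)

Definition graph_mean (R : realType) (n : nat) (p s : R)
    (f : graph n -> graph n -> R) : R :=
  \sum_(G0 : graph n) \sum_(G1 : graph n) \sum_(H : graph n)
    bernoulli_subset (vertex_pairs n) p G0 * bernoulli_subset G0 s G1 *
    bernoulli_subset G0 s H * f G1 H.

Lemma bernoulli_subset_ge0 (R : realType) (T : finType) (D E : {set T}) (q : R) :
  0 <= q <= 1 -> 0 <= bernoulli_subset D q E.
Proof.
move=> /andP[q0 q1]; rewrite /bernoulli_subset; case: ifP => // _.
by apply: prodr_ge0 => e _; case: ifP => // _; rewrite subr_ge0.
Qed.

(** Distributivity turns a product of binary sums into a sum over subsets. Allowing [P] to exceed
    [D] lets the formula apply to a subgraph of a random parent while the product runs over all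
    vertex pairs. *)
Lemma bernoulli_subset_prod (R : realType) (T : finType) (D P : {set T}) (q : R)
    (f : T -> bool -> R) : D \subset P ->
  \sum_(E : {set T}) bernoulli_subset D q E * \prod_(e in P) f e (e \in E) =
  \prod_(e in P)
    (if e \in D then q * f e true + (1 - q) * f e false else f e false).
Proof.
move=> DP.
(* [F] and [G] are the contributions of [e] inside and outside [E]; [F] vanishes off [D], which
   kills every [E] not included in [D]. *)
pose F e := if e \in P then if e \in D then q * f e true else 0 else 0.
pose G e := if e \in P then
  if e \in D then (1 - q) * f e false else f e false else 1.
transitivity (\prod_e (F e + G e)); last first.
  rewrite [RHS]big_mkcond /=; apply: eq_bigr => e _; rewrite /F /G.
  by case: ifP => _; [case: ifP => _ //|]; rewrite add0r.
rewrite bigA_distr; apply: eq_bigr => E _; rewrite /bernoulli_subset.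
case: ifPn => [ED|/subsetPn[e eE eD]]; last first.
  rewrite mul0r (bigD1 e)//= eE /F (negPf eD).
  by case: ifP; rewrite mul0r.
rewrite (big_mkcond (mem D)) (big_mkcond (mem P)) -big_split /=.
apply: eq_bigr => e _; rewrite /F /G.
have [eE|eE] := boolP (e \in E).
  by rewrite (subsetP ED e eE) (subsetP DP e (subsetP ED e eE)).
have [eD|eD] := boolP (e \in D); first by rewrite (subsetP DP e eD).
by case: ifP; rewrite ?mul1r ?mulr1.
Qed.

Lemma graph_mean_prod (R : realType) (n : nat) (p s : R)
    (f g : {set 'I_n} -> bool -> R) :
  graph_mean p s (fun G1 H => \prod_(e in vertex_pairs n)
    f e (e \in G1) * \prod_(e in vertex_pairs n) g e (e \in H)) =
  \prod_(e in vertex_pairs n)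
    (p * ((s * f e true + (1 - s) * f e false) *
          (s * g e true + (1 - s) * g e false)) +
     (1 - p) * (f e false * g e false)).
Proof.
(* [h e b] is the conditional mean of the factors at [e], given whether [e] is in the parent
   graph. *)
pose h e (b : bool) := if b then (s * f e true + (1 - s) * f e false) *
  (s * g e true + (1 - s) * g e false) else f e false * g e false.
have := @bernoulli_subset_prod R _ (vertex_pairs n) (vertex_pairs n) p h (subxx _).
under [X in _ = X -> _]eq_bigr => e eP do rewrite eP.
move=> <-; apply: eq_bigr => G0 _.
have [sG|sG] := boolP (G0 \subset vertex_pairs n); last first.
  rewrite [X in _ = X * _]/bernoulli_subset (negPf sG) mul0r.
  rewrite big1// => G1 _; rewrite big1// => H _.
  by rewrite /bernoulli_subset (negPf sG) !mul0r.
have hE e b : h e b = (if b then s * f e true + (1 - s) * f e false else f e false) *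
    (if b then s * g e true + (1 - s) * g e false else g e false) by case: b.
under [in RHS]eq_bigr => e _ do rewrite hE.
rewrite big_split /= -!(@bernoulli_subset_prod R _ G0 (vertex_pairs n))//.
rewrite mulr_suml mulr_sumr; apply: eq_bigr => G1 _.
by rewrite !mulr_sumr; apply: eq_bigr => H _; ring.
Qed.

Lemma graph_mean_le (R : realType) (n : nat) (p s : R)
    (f g : graph n -> graph n -> R) : 0 <= p <= 1 -> 0 <= s <= 1 ->
  (forall G1 H, f G1 H <= g G1 H) -> graph_mean p s f <= graph_mean p s g.
Proof.
move=> p01 s01 fg; rewrite /graph_mean.
apply: ler_sum => G0 _; apply: ler_sum => G1 _; apply: ler_sum => H _.
by rewrite ler_wpM2l// !mulr_ge0 ?bernoulli_subset_ge0.
Qed.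

Lemma graph_meanZ (R : realType) (n : nat) (p s c : R)
    (f : graph n -> graph n -> R) :
  graph_mean p s (fun G1 H => c * f G1 H) = c * graph_mean p s f.
Proof.
rewrite /graph_mean.
do 3! (rewrite mulr_sumr; apply: eq_bigr => ? _).
by rewrite mulrCA.
Qed.

Lemma graph_mean_sum (R : realType) (n : nat) (p s : R) (I : finType)
    (P : pred I) (f : I -> graph n -> graph n -> R) :
  graph_mean p s (fun G1 H => \sum_(i | P i) f i G1 H) =
  \sum_(i | P i) graph_mean p s (f i).
Proof.
rewrite /graph_mean.
do 3! (rewrite [RHS]exchange_big /=; apply: eq_bigr => ? _).
by rewrite mulr_sumr.
Qed.

Lemma graph_meanD (R : realType) (n : nat) (p s : R)
    (f g : graph n -> graph n -> R) :
  graph_mean p s (fun G1 H => f G1 H + g G1 H) =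
  graph_mean p s f + graph_mean p s g.
Proof.
rewrite /graph_mean.
do 3! (rewrite -big_split; apply: eq_bigr => ? _).
by rewrite mulrDr.
Qed.

Lemma graph_mean1 (R : realType) (n : nat) (p s : R) :
  graph_mean p s (fun _ _ : graph n => 1) = 1.
Proof.
have := @graph_mean_prod R n p s (fun _ _ => 1) (fun _ _ => 1).
rewrite !big1_eq mulr1 => ->; apply: big1 => e _; ring.
Qed.

(** A pair in both [X] and [Y] needs its parent edge only once: its probability is p s^2, that is (p
    s)^2 corrected by p^-1. *)
Lemma graph_mean_monomial (R : realType) (n : nat) (p s : R) (X Y : graph n) :
  p != 0 -> X \subset vertex_pairs n -> Y \subset vertex_pairs n ->
  graph_mean p s (fun G1 H => ((X \subset G1) && (Y \subset H))%:R) =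
  (p * s) ^+ #|X| * (p * s) ^+ #|Y| * p^-1 ^+ #|X :&: Y|.
Proof.
move=> p0 XP YP.
have indE (Z G : graph n) : Z \subset vertex_pairs n ->
    (Z \subset G)%:R = \prod_(e in vertex_pairs n)
      (if e \in Z then (e \in G)%:R else 1) :> R.
  move=> ZP; rewrite -big_mkcondr /= -natr_prod; congr _%:R.
  have [ZG|/subsetPn[e eZ eG]] := boolP (Z \subset G).
    by rewrite big1// => e /andP[_ eZ]; rewrite (subsetP ZG e eZ).
  by rewrite (bigD1 e) /= ?(subsetP ZP)// (negPf eG).
have powE (Z : graph n) (a : R) : Z \subset vertex_pairs n ->
    a ^+ #|Z| = \prod_(e in vertex_pairs n) (if e \in Z then a else 1).
  move=> ZP; rewrite -big_mkcondr /= -prodr_const; apply: eq_bigl => e.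
  by case: (boolP (e \in Z)) => [/(subsetP ZP)->//|]; rewrite andbF.
rewrite !powE ?(subset_trans (subsetIl _ _))// -!big_split /=.
pose ind (Z : graph n) e (b : bool) : R := if e \in Z then b%:R else 1.
transitivity (graph_mean p s (fun G1 H =>
    \prod_(e in vertex_pairs n) ind X e (e \in G1) *
    \prod_(e in vertex_pairs n) ind Y e (e \in H))).
  rewrite /graph_mean; do 3! apply: eq_bigr => ? _.
  by rewrite -!indE// -natrM mulnb.
rewrite graph_mean_prod; apply: eq_bigr => e _; rewrite /ind inE.
by case: ifP; case: ifP => _ _ /=; field.
Qed.

(* Expanding the product reduces independence of the factors to the moments of
   the monomials 1{X \subset G1} 1{Y \subset H}. *)
Lemma graph_mean_indep (R : realType) (n : nat) (p s : R) (I : finType)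
    (S : {set I}) (e1 e2 : I -> {set 'I_n}) (c : I -> R) :
  p != 0 -> {in S, forall i, #|e1 i| = 2%N /\ #|e2 i| = 2%N} ->
  {in S &, injective e1} -> {in S &, injective e2} ->
  {in S &, forall i j, e1 i = e2 j -> i = j} ->
  graph_mean p s (fun G1 H =>
    \prod_(i in S) (1 + c i * ((e1 i \in G1) && (e2 i \in H))%:R)) =
  \prod_(i in S) (1 + c i * (if e1 i == e2 i then p * s ^+ 2 else (p * s) ^+ 2)).
Proof.
move=> p0 card2 inj1 inj2 inj12.
have expand (g : I -> R) : \prod_(i in S) (1 + g i) =
    \sum_(J : {set I} | J \subset S) \prod_(i in J) g i.
  rewrite big_mkcond /=.
  have gE i : (if i \in S then 1 + g i else 1) = (if i \in S then g i else 0) + 1.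
    by case: ifP; rewrite addrC ?addr0.
  under eq_bigr => i _ do rewrite gE.
  rewrite bigA_distr [RHS]big_mkcond; apply: eq_bigr => J _ /=.
  case: ifPn => [JS|/subsetPn[i iJ iS]].
    rewrite [RHS]big_mkcond /=; apply: eq_bigr => i _.
    by case: ifP => // /(subsetP JS) ->.
  by rewrite (bigD1 i)//= iJ (negPf iS) mul0r.
rewrite expand.
transitivity (graph_mean p s (fun G1 H => \sum_(J : {set I} | J \subset S)
   (\prod_(i in J) c i) *
   ((e1 @: J \subset G1) && (e2 @: J \subset H))%:R)).
  rewrite /graph_mean; apply: eq_bigr => G0 _.
  apply: eq_bigr => A _; apply: eq_bigr => B _.
  rewrite expand; congr (_ * _); apply: eq_bigr => J JS.
  rewrite big_split /=; congr (_ * _).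
  case: andP => [[/subsetP s1 /subsetP s2]|sN].
    by apply: big1 => i iJ; rewrite s1 ?s2 ?imset_f.
  have [i iJ /negPf iN] : exists2 i, i \in J & ~~ ((e1 i \in A) && (e2 i \in B)).
    apply/exists_inP; rewrite -negb_forall_in; apply/negP => /forall_inP h.
    by apply: sN; split; apply/subsetP => _ /imsetP[i iJ ->]; have /andP[] := h i iJ.
  by rewrite (bigD1 i)//= iN mul0r.
rewrite graph_mean_sum; apply: eq_bigr => J JS.
have sJ i : i \in J -> i \in S by apply/subsetP.
rewrite graph_meanZ big_split /=; congr (_ * _).
have sub (e : I -> {set 'I_n}) : {in S, forall i, #|e i| = 2%N} ->
    e @: J \subset vertex_pairs n.
  by move=> h; apply/subsetP => _ /imsetP[i /sJ iS ->]; rewrite inE h.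
rewrite graph_mean_monomial ?sub//; [|by move=> i /card2[]|by move=> i /card2[]].
rewrite !card_in_imset; [|by move=> i j /sJ iS /sJ jS; apply: inj2|
  by move=> i j /sJ iS /sJ jS; apply: inj1].
(* An edge common to both images comes from the same index on each side, so the correction p^-1 is
   also distributed index by index. *)
have -> : e1 @: J :&: e2 @: J = e1 @: [set i in J | e1 i == e2 i].
  apply/setP => e; rewrite inE; apply/andP/imsetP.
    case=> /imsetP[i iJ ->] /imsetP[j jJ eij].
    by exists i => //; rewrite inE iJ {2}(inj12 i j) ?sJ// eij eqxx.
  move=> [i]; rewrite inE => /andP[iJ /eqP ei] ->.
  by rewrite imset_f// ei imset_f.
rewrite card_in_imset; last first.
  by move=> i j; rewrite !inE => /andP[/sJ iS _] /andP[/sJ jS _]; apply: inj1.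
have -> : p^-1 ^+ #|[set i in J | e1 i == e2 i]| =
    \prod_(i in J) (if e1 i == e2 i then p^-1 else 1).
  by rewrite -prodr_const -big_mkcondr; apply: eq_bigl => i; rewrite inE.
rewrite -!prodr_const -!big_split /=; apply: eq_bigr => i _.
by case: ifP => _; field.
Qed.

(** * Witness counts and greedy matching *)

Lemma graph_dist1E (n : nat) (G : graph n) (u v : 'I_n) :
  (2 <= n)%N -> (graph_dist G u v == Some 1%N) = adj G u v.
Proof.
move: G u v; case: n => [//|[//|m]] G u v _; rewrite /graph_dist.
have walk0 : has_walk G u v 0 = (u == v).
  apply/existsP/eqP => [[q]|->]; first by rewrite tuple0 /= => /eqP.
  by exists [tuple] => /=.
have walk1 : has_walk G u v 1 = adj G u v.
  apply/existsP/idP => [[q]|uv]; last by exists [tuple v]; rewrite /= uv eqxx.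
  by case/tupleP: q => x q; rewrite tuple0 /= andbT => /andP[uv /eqP <-].
rewrite /= walk0 walk1; have [<-|_ /=] := eqVneq u v; first by rewrite /adj eqxx.
by case: (adj G u v) => //=; case: ifP.
Qed.

Lemma adj_relabel (n : nat) (f : {perm 'I_n}) (G : graph n) (x y : 'I_n) :
  adj (relabel f G) (f x) (f y) = adj G x y.
Proof.
rewrite /adj (inj_eq perm_inj) /relabel.
have -> : [set f x; f y] = f @: [set x; y] by rewrite imsetU1 imset_set1.
by rewrite mem_imset//; apply: imset_inj; apply: perm_inj.
Qed.

(** Undoing [pistar] moves the second adjacency back to [H]. The indices left out are those for
    which one of the two pairs degenerates to a singleton. *)
Lemma witnesses1E (n : nat) (G1 H : graph n) (pistar sigma : {perm 'I_n})
    (u x : 'I_n) : (2 <= n)%N ->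
  witnesses 1 G1 (relabel pistar H) sigma u (pistar x) =
  (\sum_(w in [set w | (w != u) && ((sigma * pistar^-1)%g w != x)])
    (([set u; w] \in G1) &&
     ([set x; (sigma * pistar^-1)%g w] \in H)))%N.
Proof.
move=> n2; rewrite /witnesses -sum1_card big_mkcond [RHS]big_mkcond /=.
apply: eq_bigr => w _; rewrite !inE !graph_dist1E//.
have -> : sigma w = pistar ((sigma * pistar^-1)%g w) by rewrite permM permKV.
rewrite adj_relabel /adj (eq_sym u) (eq_sym x).
by rewrite andbACA; case: ((w != u) && _) => //=; case: (_ && _).
Qed.

(** If all earlier matches are true and [x.1] is free, then [pistar x.1] is free too by injectivity,
    so a wrong choice in that row would not be maximal. *)
Lemma greedy_output_row_dominant (n : nat) (W : 'I_n -> 'I_n -> nat)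
    (pistar tau : {perm 'I_n}) :
  (forall u v, v != pistar u -> (W u v < W u (pistar u))%N) ->
  greedy_output W tau -> tau = pistar.
Proof.
move=> dom [r run tau_r]; suff rP x : x \in r -> x.2 = pistar x.1.
  by apply/permP => u; have := rP _ (tau_r u).
elim: run x => {r tau_r} [//|r x _ IH /andP[x1 _] xmax] y.
rewrite inE => /predU1P[->|]; last exact: IH.
apply/eqP; apply/negP => /negP /dom; rewrite ltnNge (xmax (x.1, pistar x.1))//.
rewrite /unmatched x1 /=; apply/mapP => -[[a b] abr /= eb].
have /= ab := IH _ abr; case/mapP: x1; exists (a, b) => //=.
by apply: (@perm_inj _ pistar); rewrite eb.
Qed.

(** * Exponential moments of the witness counts *)

(** Greedy colouring: a new point [x] has to avoid only the colours of its image and its preimage,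
    so one of three colours is left. *)
Lemma perm_coloring3 (T : finType) (tau : {perm T}) :
  exists col : T -> 'I_3, forall w, tau w != w -> col (tau w) != col w.
Proof.
suff [col colP] : exists col : T -> 'I_3, {in enum T, forall w,
    tau w \in enum T -> tau w != w -> col (tau w) != col w}.
  by exists col => w; apply: colP; rewrite mem_enum.
elim: (enum T) => [|x s [col colP]]; first by exists (fun _ => ord0).
have [a] : exists a, a \in ~: [set col (tau x); col ((tau^-1)%g x)].
  apply/set0Pn; rewrite -card_gt0 cardsCs setCK card_ord subn_gt0.
  by rewrite (leq_ltn_trans (leq_card_setU _ _))// !cards1.
rewrite !inE negb_or => /andP[a1 a2].
exists (fun z => if z == x then a else col z) => w.
rewrite !inE; have [->|wx] := eqVneq w x; first by move=> _ _ /negPf ->; rewrite eq_sym.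
have [twx _ _ _|twx] := eqVneq (tau w) x; last exact: colP.
by move: a2; rewrite -twx permK.
Qed.

(* The witness count of (u, pistar x), with tau = pistar^-1 o sigma and H the
   second graph before relabelling: see witnesses1E. *)
Definition edge_matches (n : nat) (tau : {perm 'I_n}) (u x : 'I_n)
    (G1 H : graph n) : nat :=
  (\sum_(w in [set w | (w != u) && (tau w != x)])
    (([set u; w] \in G1) && ([set x; tau w] \in H)))%N.

Lemma set2_injr (T : finType) (u : T) : injective (fun w => [set u; w]).
Proof.
move=> w w' /= e; have := set22 u w; rewrite e => /set2P[wu|//].
by have := set22 u w'; rewrite -e wu => /set2P[] ->.
Qed.

(** Gives the exponential of an indicator the affine form required by [graph_mean_indep]. *)
Lemma expR_bool (R : realType) (x : R) (b : bool) :
  expR (x * b%:R) = 1 + (expR x - 1) * b%:R.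
Proof. by case: b; rewrite ?mulr1 ?mulr0 ?expR0 ?addr0// addrC subrK. Qed.

Lemma edge_matches_mgf_neq (R : realType) (n : nat) (p s lam : R)
    (tau : {perm 'I_n}) (u x : 'I_n) :
  0 < p <= 1 -> 0 <= s <= 1 -> 0 <= lam -> u != x ->
  graph_mean p s (fun G1 H => expR (lam * (edge_matches tau u x G1 H)%:R)) <=
  expR (lam * 2 + n%:R * (p * s) ^+ 2 * (expR lam - 1)).
Proof.
move=> /andP[p0 p1] s01 lam0 ux.
set D := [set w | (w != u) && (tau w != x)].
(* As [u != x], the edges {u, w} and {x, tau w'} coincide only if w = x and tau w' = u. Dropping
   such indices leaves independent summands, and the at most two lost cost a factor
   [expR (lam * 2)]. *)
pose S := [set w in D | (w != x) && (tau w != u)].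
have SD : S \subset D by apply/subsetP => w /setIdP[].
have cardDS : (#|D :\: S| <= 2)%N.
  apply: leq_trans (subset_leq_card (_ : _ \subset [set x; (tau^-1)%g u])) _.
    apply/subsetP => w; rewrite !inE => /andP[+ wD]; rewrite wD /= negb_and !negbK.
    by case/orP => [->//|/eqP <-]; rewrite permK eqxx orbT.
  by rewrite (leq_trans (leq_card_setU _ _))// !cards1.
have c0 : 0 <= expR lam - 1 by rewrite subr_ge0 -expR0 ler_expR.
have p01 : 0 <= p <= 1 by rewrite ltW.
apply: le_trans (_ : graph_mean p s (fun G1 H => expR (lam * 2) *
    \prod_(w in S) (1 + (expR lam - 1) *
      (([set u; w] \in G1) && ([set x; tau w] \in H))%:R)) <= _).
  apply: graph_mean_le => // G1 H; under eq_bigr => w _ do rewrite -expR_bool.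
  rewrite -expR_sum -mulr_sumr -expRD -mulrDr ler_expR ler_wpM2l//.
  rewrite -natr_sum -natrD ler_nat /edge_matches -/D (big_setID S) /=.
  rewrite (setIidPr SD) addnC leq_add2r (leq_trans _ cardDS)// -sum1_card.
  by apply: leq_sum => w _; case: (_ && _).
rewrite graph_meanZ expRD ler_wpM2l ?expR_ge0//.
have eN w w' : w' \in S -> [set u; w] != [set x; tau w'].
  rewrite !inE => /andP[_ /andP[_ tu]]; apply/eqP => e.
  have := set21 u w; rewrite e !inE (negPf ux) eq_sym (negPf tu).
  by [].
rewrite graph_mean_indep ?gt_eqF//.
- rewrite -mulrA expRM_natl -[in leRHS](card_ord n) -prodr_const.
  (* The right side has [n] factors; those outside [S] are at least 1. *)
  rewrite [leRHS](bigID (mem S)) /= -[leLHS]mulr1; apply: ler_pM => //.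
  + apply: prodr_ge0 => w _; rewrite addr_ge0// mulr_ge0//.
    by case: ifP => _; rewrite ?sqr_ge0// mulr_ge0 ?sqr_ge0// ltW.
  + apply: ler_prod => w wS; rewrite (negPf (eN w w wS)) mulrC.
    by rewrite expR_ge1Dx andbT addr_ge0// mulr_ge0// sqr_ge0.
  + rewrite -[leLHS](@big1_eq _ _ *%R _ (index_enum 'I_n) (fun w => w \notin S)).
    apply: ler_prod => w _; rewrite ler01 (le_trans _ (expR_ge1Dx _))//.
    by rewrite lerDl mulr_ge0// sqr_ge0.
- move=> w wS; have := wS; rewrite !inE => /andP[/andP[wu tx] _].
  by rewrite !cards2 (eq_sym u) (eq_sym x) wu tx.
- by move=> w w' _ _; apply: set2_injr.
- by move=> w w' _ _ /set2_injr /perm_inj.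
- by move=> w w' _ /(eN w) /eqP.
Qed.

(** The mean of the summand at [w] for a true pair: at a fixed point of [tau] both graphs are asked
    for the same edge. *)
Definition match_prob (R : realType) (n : nat) (p s : R) (tau : {perm 'I_n})
    (w : 'I_n) : R :=
  if tau w == w then p * s ^+ 2 else (p * s) ^+ 2.

(* The edges used by w and tau w overlap, so independence holds only within a
   colour class; the non-fixed points have weight 3 lam to make the average over
   the three classes equal to the full exponent. *)
Lemma edge_matches_mgf_eq (R : realType) (n : nat) (p s lam : R)
    (tau : {perm 'I_n}) (u : 'I_n) :
  0 < p <= 1 -> 0 <= s <= 1 -> 0 <= lam ->
  graph_mean p s (fun G1 H => expR (lam *
    (\sum_(w in [set w | (w != u) && (tau w != u)]) match_prob p s tau w -
     (edge_matches tau u u G1 H)%:R))) <=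
  expR (5 / 8 * lam ^+ 2 *
    (#|[set w | tau w == w]|%:R * (p * s ^+ 2) + n%:R * (9 * (p * s) ^+ 2))).
Proof.
move=> /andP[p0 p1] s01 lam0; have [s0 s1] := andP s01.
set D := [set w | (w != u) && (tau w != u)].
have [col colP] := perm_coloring3 tau.
(* Fixed points belong to all three classes, other points to one; the weights [l] compensate for
   this in the average. *)
pose S c := [set w in D | (tau w == w) || (col w == c)].
pose l w := if tau w == w then lam else 3 * lam.
pose q := match_prob p s tau.
pose I w (G1 H : graph n) : R := (([set u; w] \in G1) && ([set u; tau w] \in H))%:R.
have l0 w : 0 <= l w by rewrite /l; case: ifP => _ //; rewrite mulr_ge0.
have q0 w : 0 <= q w.
  by rewrite /q /match_prob; case: ifP => _; rewrite ?sqr_ge0// mulr_ge0 ?sqr_ge0// ltW.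
have q1 w : q w <= 1.
  have s2 : s ^+ 2 <= 1 by rewrite exprn_ile1.
  rewrite /q /match_prob; case: ifP => _; first by rewrite mulr_ile1 ?sqr_ge0// ltW.
  by rewrite exprMn mulr_ile1 ?sqr_ge0// exprn_ile1// ltW.
have p01 : 0 <= p <= 1 by rewrite ltW.
have split G1 H : lam * (\sum_(w in D) q w - (edge_matches tau u u G1 H)%:R) =
    3^-1 * \sum_(c < 3) \sum_(w in S c) l w * (q w - I w G1 H).
  rewrite /edge_matches -/D natr_sum -sumrB.
  under [X in _ = _ * X]eq_bigr => c _.
    rewrite (eq_bigl (fun w => (w \in D) && ((tau w == w) || (col w == c)))).
      rewrite big_mkcondr /=.
      over.
    by move=> w; rewrite inE.
  rewrite exchange_big /= !mulr_sumr; apply: eq_bigr => w _.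
  rewrite -big_mkcond /= -/(I w G1 H) /l; case: (tau w == w) => /=.
    rewrite big_const_ord iter_addr_0 -[(_ * _) *+ 3]mulr_natl mulKf ?pnatr_eq0//.
  by rewrite (big_pred1 (col w))//= mulrA mulrA mulVf ?mul1r// pnatr_eq0.
apply: le_trans (_ : graph_mean p s (fun G1 H => 3^-1 *
    \sum_(c < 3) expR (\sum_(w in S c) l w * (q w - I w G1 H))) <= _).
  by apply: graph_mean_le => // G1 H; rewrite split expR_mean3.
rewrite graph_meanZ graph_mean_sum mulrC ler_pdivrMr ?ltr0n//.
set b := expR _; have -> : b * 3 = \sum_(c < 3) b.
  by rewrite big_const_ord iter_addr_0 mulr_natr.
apply: ler_sum => c _ {split}.
have expand : graph_mean p s (fun G1 H =>
      expR (\sum_(w in S c) l w * (q w - I w G1 H))) =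
    (\prod_(w in S c) expR (l w * q w)) *
    \prod_(w in S c) (1 + (expR (- l w) - 1) * q w).
  have SE w : w \in S c -> q w =
      if [set u; w] == [set u; tau w] then p * s ^+ 2 else (p * s) ^+ 2.
    by move=> _; rewrite (inj_eq (@set2_injr _ u)) eq_sym.
  rewrite (eq_bigr _ (fun w wS =>
    congr1 (fun z => 1 + (expR (- l w) - 1) * z) (SE w wS))).
  rewrite -graph_mean_indep ?gt_eqF//.
  - rewrite -graph_meanZ /graph_mean; apply: eq_bigr => G0 _.
    apply: eq_bigr => G1 _; apply: eq_bigr => H _; congr (_ * _).
    rewrite expR_sum -big_split /=; apply: eq_bigr => w _.
    by rewrite mulrBr expRD -mulNr expR_bool.
  - move=> w; rewrite !inE => /andP[/andP[wu tu] _].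
    by rewrite !cards2 !(eq_sym u) wu tu.
  - by move=> w w' _ _; apply: set2_injr.
  - by move=> w w' _ _ /set2_injr /perm_inj.
  (* Equal edges force w = tau w'. If w' is not fixed, neither is w, and both have colour [c],
     contradicting the colouring. *)
  - move=> w w'; rewrite !inE => /andP[_ wc] /andP[_ w'c] /set2_injr e.
    have [fix'|nfix] := eqVneq (tau w') w'; first by rewrite e.
    have := colP _ nfix; move: wc w'c.
    rewrite (negPf nfix) /= e (inj_eq perm_inj) (negPf nfix).
    by move=> /= /eqP -> /eqP ->; rewrite eqxx.
rewrite expand -big_split /=.
(* By 1 + y <= exp y the exponent is at most q (l + exp(-l) - 1); the linear terms in [l] cancel in
   the quadratic bound. *)
apply: le_trans (_ : \prod_(w in S c) expR (5 / 8 * (l w ^+ 2 * q w)) <= _).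
  apply: ler_prod => w _; rewrite mulr_ge0 ?expR_ge0//=; last first.
    have := q1 w; have := q0 w; have := expR_ge0 (- l w); nra.
  apply: le_trans (ler_wpM2l (expR_ge0 _) (expR_ge1Dx _)) _.
  rewrite -expRD ler_expR.
  have := ler_wpM2r (q0 w) (expRN_le_quadratic (l0 w)); rewrite mulrBl mul1r; lra.
rewrite -expR_sum ler_expR -mulr_sumr -[leRHS]mulrA ler_wpM2l ?divr_ge0//.
apply: le_trans (_ : \sum_w (lam ^+ 2 *
    ((if tau w == w then p * s ^+ 2 else 0) + 9 * (p * s) ^+ 2)) <= _).
  rewrite big_mkcond /=; apply: ler_sum => w _.
  have ps0 := sqr_ge0 (p * s).
  have ps0' : 0 <= p * s ^+ 2 by rewrite mulr_ge0 ?sqr_ge0// ltW.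
  rewrite /l /q /match_prob; case: ifP => _; case: ifP => _.
  - by rewrite ler_wpM2l ?sqr_ge0// lerDl mulr_ge0.
  - by rewrite le_eqVlt; apply/orP; left; apply/eqP; ring.
  - by rewrite mulr_ge0 ?sqr_ge0// addr_ge0// mulr_ge0.
  - by rewrite mulr_ge0 ?sqr_ge0// addr_ge0// mulr_ge0.
rewrite -mulr_sumr ler_wpM2l ?sqr_ge0// big_split /= -big_mkcond /=.
rewrite big_const_ord iter_addr_0 !mulr_natl lerD2r -sumr_const.
by rewrite le_eqVlt; apply/orP; left; apply/eqP; apply: eq_bigl => w; rewrite inE.
Qed.

(** A fixed point exceeds the base value (p s)^2 by p s^2 (1 - p); the at most two omitted indices
    cost at most 1 each. *)
Lemma match_prob_sum_ge (R : realType) (n : nat) (p s : R)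
    (tau : {perm 'I_n}) (u : 'I_n) : 0 <= p <= 1 -> 0 <= s <= 1 ->
  n%:R * (p * s) ^+ 2 + #|[set w | tau w == w]|%:R * (p * s ^+ 2) * (1 - p) - 2 <=
  \sum_(w in [set w | (w != u) && (tau w != u)]) match_prob p s tau w.
Proof.
move=> /andP[p0 p1] /andP[s0 s1]; set D := [set w | _ && _].
have cardD : (#|~: D| <= 2)%N.
  apply: leq_trans (subset_leq_card (_ : _ \subset [set u; (tau^-1)%g u])) _.
    apply/subsetP => w; rewrite !inE negb_and !negbK.
    by case/orP => [->//|/eqP <-]; rewrite permK eqxx orbT.
  by rewrite (leq_trans (leq_card_setU _ _))// !cards1.
rewrite lerBlDr.
have q1 w : match_prob p s tau w <= 1.
  have s2 : s ^+ 2 <= 1 by rewrite exprn_ile1.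
  rewrite /match_prob; case: ifP => _; first by rewrite mulr_ile1 ?sqr_ge0.
  by rewrite exprMn mulr_ile1 ?sqr_ge0// exprn_ile1.
apply: le_trans (_ : \sum_w match_prob p s tau w <= _); last first.
  rewrite (bigID (mem D)) /= lerD2l.
  apply: le_trans (ler_sum _ (fun w _ => q1 w)) _.
  rewrite (eq_bigl (mem (~: D))) => [|w]; last by rewrite /= in_setC.
  by rewrite sumr_const ler_nat.
have qE w : match_prob p s tau w =
    (p * s) ^+ 2 + (if tau w == w then p * s ^+ 2 * (1 - p) else 0).
  by rewrite /match_prob; case: ifP => _; ring.
rewrite (eq_bigr _ (fun w _ => qE w)) big_split /= -big_mkcond big_const_ord.
rewrite iter_addr_0 [n%:R * _]mulr_natl lerD2l -[leLHS]mulrA mulr_natl -sumr_const.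
by rewrite le_eqVlt; apply/orP; left; apply/eqP; apply: eq_bigl => w; rewrite inE.
Qed.

(** * Averaging over the seed mapping *)

Lemma uniform_on_sum (R : realType) (T : finType) (A : {set T}) :
  A != set0 -> \sum_x uniform_on R A x = 1.
Proof.
move=> A0; rewrite /uniform_on -big_mkcond /= sumr_const -[LHS]mulr_natr mulVf//.
by rewrite pnatr_eq0 cards_eq0.
Qed.

(** Independence of the seed from the graphs reduces the analysis to a fixed [sigma]. *)
Lemma model_probE (R : realType) (n : nat) (p s beta : R)
    (pistar : {perm 'I_n}) (event : graph n -> graph n -> {perm 'I_n} -> bool) :
  model_prob p s beta pistar event =
  \sum_sigma uniform_on R (seed_mappings beta pistar) sigma *
    graph_mean p s (fun G1 H => (event G1 (relabel pistar H) sigma)%:R).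
Proof.
rewrite /model_prob /graph_mean.
under [RHS]eq_bigr => sigma _ do rewrite mulr_sumr.
rewrite [RHS]exchange_big /=; apply: eq_bigr => G0 _.
under [RHS]eq_bigr => sigma _ do rewrite mulr_sumr.
rewrite [RHS]exchange_big /=; apply: eq_bigr => G1 _.
under [RHS]eq_bigr => sigma _ do rewrite mulr_sumr.
rewrite [RHS]exchange_big /=; apply: eq_bigr => H _.
rewrite big_mkcond /=; apply: eq_bigr => sigma _.
by case: (event _ _ _); rewrite ?mulr0 ?mulr1 1?mulrC.
Qed.

Lemma tilt_bounds (R : realType) (L D V r : R) (Delta := D * r)
    (lam := 12 * L / Delta) :
  0 < L -> 0 <= V -> 0 < r <= 1 -> 45 * L <= Delta * r ->
  900 * V * L <= Delta ^+ 2 ->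
  [/\ 0 <= lam,
      lam * (2 - Delta / 2) + 5 / 8 * lam ^+ 2 * (D + 9 * V) <= 1 - 3 * L &
      lam * 2 + V * (expR lam - 1) - lam * (V + Delta / 2) <= 1 - 4 * L].
Proof.
move=> L0 V0 /andP[r0 r1] h1 h2.
have D45 : 45 * L <= Delta.
  have : 0 < Delta * r by apply: lt_le_trans h1; rewrite mulr_gt0.
  rewrite pmulr_lgt0// => d0; apply: le_trans h1 _.
  by rewrite -[leRHS]mulr1 ler_wpM2l// ltW.
have d0 : 0 < Delta by apply: lt_le_trans D45; rewrite mulr_gt0.
have lamD : lam * Delta = 12 * L by rewrite /lam divfK// gt_eqF.
have lam0 : 0 <= lam by rewrite divr_ge0 ?(ltW d0)// mulr_ge0// ltW.
have lam1 : lam <= 12 / 45.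
  by rewrite /lam ler_pdivrMr//; lra.
(* Multiplying by [Delta * r] makes the left side (lam Delta)^2 = 144 L^2, since [D * r] is
   [Delta]. *)
have lamDD : lam ^+ 2 * D <= 144 / 45 * L.
  rewrite -(ler_pM2r (mulr_gt0 d0 r0)).
  have -> : lam ^+ 2 * D * (Delta * r) = 144 * L * L.
    have -> : lam ^+ 2 * D * (Delta * r) = (lam * Delta) * (lam * Delta).
      by rewrite /Delta; ring.
    by rewrite lamD; ring.
  nra.
have lamV : lam ^+ 2 * V <= 144 / 900 * L.
  rewrite -(ler_pM2r (mulr_gt0 d0 d0)).
  have -> : lam ^+ 2 * V * (Delta * Delta) = (lam * Delta) * (lam * Delta) * V by ring.
  by rewrite lamD; nra.
have h3 : lam * (2 - Delta / 2) = 2 * lam - 6 * L.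
  have -> : lam * (2 - Delta / 2) = 2 * lam - lam * Delta / 2 by field.
  by rewrite lamD; field.
split=> //.
  rewrite h3.
  have -> : 5 / 8 * lam ^+ 2 * (D + 9 * V) =
    5 / 8 * (lam ^+ 2 * D) + 45 / 8 * (lam ^+ 2 * V) by field.
  lra.
have he : expR lam <= 1 + lam + 3 / 2 * lam ^+ 2.
  by apply: expR_le_quadratic; apply/andP; split => //; lra.
have h4 : V * (expR lam - 1) <= V * lam + 3 / 2 * (lam ^+ 2 * V).
  have -> : V * lam + 3 / 2 * (lam ^+ 2 * V) = V * (lam + 3 / 2 * lam ^+ 2) by field.
  by rewrite ler_wpM2l//; lra.
have -> : lam * (V + Delta / 2) = V * lam + lam * Delta / 2 by field.
by rewrite lamD; lra.
Qed.

(** Cubing exp(1/3) <= 3/2 gives 27/8; the bound 7/2 makes 2e < 7 available. *)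
Lemma expR1_lt (R : realType) : expR 1 < 7 / 2 :> R.
Proof.
have -> : 1 = 3%:R * (1 / 3) :> R by field.
rewrite expRM_natl.
have h : expR (1 / 3) <= 3 / 2 :> R.
  apply: le_trans (expR_le_quadratic _) _; [by apply/andP; split; lra|lra].
apply: le_lt_trans (lerXn2r 3 _ _ h) _; rewrite ?nnegrE ?expR_ge0//; first by lra.
lra.
Qed.

Lemma seed_density_bounds (R : realType) (n p s beta L : R) :
  0 < n -> 0 < p < 1 -> 0 < s -> 0 < L ->
  Num.max (45 * L / (n * p * (1 - p) ^+ 2 * s ^+ 2))
      (30 * Num.sqrt (L / (n * (1 - p) ^+ 2 * s ^+ 2))) <= beta ->
  let Delta := beta * n * (p * s ^+ 2) * (1 - p) in
  45 * L <= Delta * (1 - p) /\ 900 * (n * (p * s) ^+ 2) * L <= Delta ^+ 2.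
Proof.
move=> n0 /andP[p0 p1] s0 L0; rewrite ge_max => /andP[b1 b2] Delta.
have r0 : 0 < 1 - p by rewrite subr_gt0.
split.
  move: b1; rewrite ler_pdivrMr ?mulr_gt0 ?exprn_gt0// => /le_trans; apply.
  by rewrite /Delta le_eqVlt; apply/orP; left; apply/eqP; ring.
have := lerXn2r 2 _ _ b2.
rewrite !nnegrE mulr_ge0 ?sqrtr_ge0//= (le_trans _ b2) ?mulr_ge0 ?sqrtr_ge0//.
move=> /(_ isT isT); rewrite exprMn sqr_sqrtr; last first.
  by rewrite divr_ge0 ?(ltW L0)// !mulr_ge0 ?sqr_ge0// ltW.
rewrite [30 ^+ 2 * _]mulrA.
rewrite ler_pdivrMr ?mulr_gt0 ?exprn_gt0// => h.
(* This factor turns the squared second bound on [beta] into the one on [Delta ^+ 2]. *)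
have np : 0 <= n * p ^+ 2 * s ^+ 2 by rewrite !mulr_ge0 ?sqr_ge0// ltW.
have := ler_wpM2l np h.
have -> : n * p ^+ 2 * s ^+ 2 * (30 ^+ 2 * L) = 900 * (n * (p * s) ^+ 2) * L by ring.
move=> /le_trans; apply.
by rewrite /Delta le_eqVlt; apply/orP; left; apply/eqP; ring.
Qed.

(** * Union bound for a fixed seed, and the conclusion *)

Lemma hop1_exact_mean (R : realType) (n : nat) (p s : R)
    (pistar sigma : {perm 'I_n})
    (Delta := #|[set w | sigma w == pistar w]|%:R * (p * s ^+ 2) * (1 - p))
    (alg : graph n -> graph n -> {perm 'I_n} -> {perm 'I_n}) :
  (7 <= n)%N -> 0 < p < 1 -> 0 < s <= 1 ->
  45 * ln n%:R <= Delta * (1 - p) ->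
  900 * (n%:R * (p * s) ^+ 2) * ln n%:R <= Delta ^+ 2 ->
  is_hop_algorithm 1 alg ->
  1 - n%:R^-1 <= graph_mean p s
    (fun G1 H => (alg G1 (relabel pistar H) sigma == pistar)%:R).
Proof.
move=> n7 /andP[p0 p1] /andP[s0 s1] h1 h2 halg.
have n2 : (2 <= n)%N by apply: leq_trans n7.
set L := ln n%:R in h1 h2; set V := n%:R * (p * s) ^+ 2 in h2.
have n1R : 1 < n%:R :> R by rewrite ltr1n.
have n0R : 0 < n%:R :> R by rewrite ltr0n (leq_trans _ n2).
have L0 : 0 < L by rewrite ln_gt0.
have p01 : 0 <= p <= 1 by rewrite !ltW.
have p01' : 0 < p <= 1 by rewrite p0 ltW.
have s01 : 0 <= s <= 1 by rewrite ltW.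
have V0 : 0 <= V by rewrite mulr_ge0 ?sqr_ge0// ltW.
have r01 : 0 < 1 - p <= 1 by apply/andP; split; lra.
pose tau := (sigma * pistar^-1)%g.
have fixE : [set w | sigma w == pistar w] = [set w | tau w == w].
  by apply/setP => w; rewrite !inE permM (canF_eq (permKV pistar)).
pose D : R := #|[set w | sigma w == pistar w]|%:R * (p * s ^+ 2).
have [] := @tilt_bounds R L D V (1 - p) L0 V0 r01 h1 h2; rewrite -/Delta.
set lam := 12 * L / Delta => lam0 b1 b2.
set T := V + Delta / 2.
pose M u x G1 H : R := (edge_matches tau u x G1 H)%:R.
(* Chernoff and union bounds in one variable: a count on the wrong side of [T] makes its term at
   least 1, so [bad] below 1 forces success and its mean bounds the failure probability. *)
pose bad G1 H : R := \sum_u expR (lam * (T - M u u G1 H)) +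
  \sum_u \sum_(x | x != u) expR (lam * (M u x G1 H - T)).
have term_le (P : pred 'I_n) (f : 'I_n -> R) i : (forall j, 0 <= f j) -> P i ->
    f i <= \sum_(j | P j) f j.
  by move=> f0 Pi; rewrite (bigD1 i)//= lerDl sumr_ge0.
have e0 u G1 H : 0 <= \sum_(x | x != u) expR (lam * (M u x G1 H - T)).
  by apply: sumr_ge0 => x _; apply: expR_ge0.
have d0 G1 H : 0 <= \sum_u expR (lam * (T - M u u G1 H)).
  by apply: sumr_ge0 => u _; apply: expR_ge0.
have bad0 G1 H : 0 <= bad G1 H by rewrite addr_ge0// sumr_ge0.
have lt1 y : expR (lam * y) < 1 -> y < 0.
  by rewrite expR_lt1; apply: contraTT; rewrite -!leNgt; apply: mulr_ge0.
have dom G1 H : bad G1 H < 1 -> alg G1 (relabel pistar H) sigma = pistar.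
  move=> small; apply: (greedy_output_row_dominant _ (halg _ _ _)) => u v.
  rewrite -(permKV pistar v); set x := (pistar^-1)%g v.
  rewrite (inj_eq perm_inj) !witnesses1E// => xu.
  rewrite -(ltr_nat R) -/(M u x G1 H) -/(M u u G1 H).
  apply: (@lt_trans _ _ T); rewrite -subr_lt0; apply: lt1; apply: le_lt_trans small.
    apply: le_trans (_ : \sum_(y | y != u) expR (lam * (M u y G1 H - T)) <= _).
      exact: (term_le (fun y => y != u) (fun y => expR (lam * (M u y G1 H - T)))
        x (fun=> expR_ge0 _) xu).
    rewrite (le_trans (term_le predT
      (fun w => \sum_(y | y != w) expR (lam * (M w y G1 H - T)))
      u (fun w => e0 w G1 H) isT))//.
    by rewrite lerDr.
  rewrite (le_trans (term_le predT (fun w => expR (lam * (T - M w w G1 H)))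
    u (fun=> expR_ge0 _) isT))//.
  by rewrite lerDl sumr_ge0.
have mean_bad : graph_mean p s bad <= n%:R^-1.
  rewrite graph_meanD !graph_mean_sum.
  apply: le_trans (_ : \sum_(u < n) expR (1 - 3 * L) +
      \sum_(u < n) n%:R * expR (1 - 4 * L) <= _).
    apply: lerD; apply: ler_sum => u _.
      (* [T] is replaced by the exact mean of the count, which is at least T + Delta/2 - 2. *)
      apply: le_trans (_ : graph_mean p s (fun G1 H =>
        expR (lam * (2 - Delta / 2)) * expR (lam *
    (\sum_(w in [set w | (w != u) && (tau w != u)]) match_prob p s tau w -
     M u u G1 H))) <= _).
        apply: graph_mean_le => // G1 H; rewrite -expRD -mulrDr ler_expR ler_wpM2l//.
        have := match_prob_sum_ge tau u p01 s01.
        by rewrite -fixE -/V -/Delta /T; lra.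
      rewrite graph_meanZ.
      apply: le_trans (ler_wpM2l (expR_ge0 _)
        (edge_matches_mgf_eq tau u p01' s01 lam0)) _.
      rewrite -expRD ler_expR; apply: le_trans b1.
      rewrite -fixE -/D /V.
      by rewrite le_eqVlt; apply/orP; left; apply/eqP; ring.
    rewrite graph_mean_sum.
    apply: le_trans (_ : \sum_(x < n | x != u) expR (1 - 4 * L) <= _); last first.
      rewrite sumr_const [n%:R * _]mulr_natl ler_wpMn2l ?expR_ge0//.
      by rewrite -[leqRHS](card_ord n) max_card.
    apply: ler_sum => x xu.
    apply: le_trans (_ : graph_mean p s (fun G1 H => expR (- (lam * T)) *
        expR (lam * M u x G1 H)) <= _).
      by apply: graph_mean_le => // G1 H; rewrite -expRD mulrBr addrC.
    rewrite graph_meanZ.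
    apply: le_trans (ler_wpM2l (expR_ge0 _)
      (edge_matches_mgf_neq tau p01' s01 lam0 _)) _.
      by rewrite eq_sym.
    by rewrite -expRD ler_expR -/V; apply: le_trans b2; rewrite addrC.
  have expL m : expR (1 - m%:R * L) = expR 1 * n%:R^-1 ^+ m.
    by rewrite expRD -mulrN expRM_natl expRN lnK.
  rewrite !big_const_ord !iter_addr_0 !expL -![(_ * _) *+ n]mulr_natl.
  have nV : n%:R * n%:R^-1 = 1 :> R by rewrite divff// gt_eqF.
  set e := expR 1; set m := n%:R^-1.
  (* True and wrong pairs each contribute e n^-2; the total is at most n^-1 once n >= 2e. *)
  have -> : n%:R * (e * m ^+ 3) + n%:R * (n%:R * (e * m ^+ 4)) =
      m * (2 * e * m) :> R.
    have -> : n%:R * (e * m ^+ 3) + n%:R * (n%:R * (e * m ^+ 4)) =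
      (n%:R * m) * e * m ^+ 2 + (n%:R * m) ^+ 2 * e * m ^+ 2 :> R by ring.
    by rewrite nV; ring.
  rewrite -[leRHS]mulr1 ler_wpM2l ?invr_ge0//.
  rewrite ler_pdivrMr// mul1r.
  have : 7 <= n%:R :> R by rewrite ler_nat.
  have := expR1_lt R; rewrite -/e; lra.
have := graph_mean_le p01 s01 (f := fun G1 H => 1) (g := fun G1 H =>
  (alg G1 (relabel pistar H) sigma == pistar)%:R + bad G1 H).
rewrite graph_mean1 graph_meanD => le1.
rewrite lerBlDr; apply: le_trans (le1 _) _; last by rewrite lerD2l.
move=> G1 H; have [/dom ->|b] := ltP (bad G1 H) 1; first by rewrite eqxx lerDl.
by rewrite (le_trans b)// lerDr.
Qed.

Theorem theorem1 (R : realType) :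
  exists N : nat, forall n : nat, (N <= n)%N -> (2 <= n)%N ->
  forall p s beta : R,
    0 < p < 1 -> 0 < s <= 1 -> 0 <= beta < 1 ->
    (exists k : nat, beta * n%:R = k%:R) ->
    Num.max
      (45 * ln n%:R / (n%:R * p * (1 - p) ^+ 2 * s ^+ 2))
      (30 * Num.sqrt (ln n%:R / (n%:R * (1 - p) ^+ 2 * s ^+ 2))) <= beta ->
  forall (pistar : {perm 'I_n}),
    seed_mappings beta pistar != set0 ->
  forall alg : graph n -> graph n -> {perm 'I_n} -> {perm 'I_n},
    is_hop_algorithm 1 alg ->
    1 - n%:R^-1 <=
      model_prob p s beta pistar (fun G1 G2 sigma => alg G1 G2 sigma == pistar).
Proof.
(* The threshold 7 comes from 2e < 7. *)
exists 7%N => n n7 n2 p s beta p01 s01 _ _ hbeta pistar seed0 alg halg.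
have n0R : 0 < n%:R :> R by rewrite ltr0n (leq_trans _ n2).
have L0 : 0 < ln n%:R :> R by rewrite ln_gt0// ltr1n.
have [s0 _] := andP s01.
have [h1 h2] := seed_density_bounds n0R p01 s0 L0 hbeta.
have -> : 1 - n%:R^-1 = \sum_sigma
    uniform_on R (seed_mappings beta pistar) sigma * (1 - n%:R^-1).
  by rewrite -mulr_suml uniform_on_sum// mul1r.
rewrite model_probE.
apply: ler_sum => sigma _; rewrite /uniform_on.
case: ifPn => [|_]; last by rewrite !mul0r.
rewrite inE => /eqP fixE; rewrite ler_wpM2l ?invr_ge0//.
(* Membership in [seed_mappings] identifies [beta * n%:R] with the number of correct seeds. *)
move: h1 h2; rewrite -fixE => h1 h2.
exact: (@hop1_exact_mean R n p s pistar sigma alg n7 p01 s01 h1 h2 halg).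
Qed.
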